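(* Let $G$ be a unicyclic graph with $n \ge 4$ vertices and maximum degree $\Delta\ge 3$, let $q=\lfloor \frac{n}{\Delta-1}\rfloor$, and let $\alpha\in(-\infty,0)\cup(1,\infty)$. If $q=1$ or $n=2\Delta-2$, then $$ M_1^{\alpha}(G) \le \Delta^\alpha + (n-\Delta+1)^\alpha + 2^\alpha + n-3. $$ If $q>1$ and $n\ne 2\Delta-2$, then $$ M_1^{\alpha}(G) \le q\Delta^\alpha + \big(n-q(\Delta-1)+1\big)^\alpha + n-q-1. $$ Moreover, in each case the upper bound is attained if and only if $G\in\mathcal{K}_n^\Delta$.
   Context: All graphs are finite, connected, simple (no loops, no multiple edges) and have at least one edge. A unicyclic graph is a graph containing exactly one cycle. For a vertex $u$ of $G$, $d_u$ denotes its degree. For $\alpha\in\mathbb{R}$, the variable first Zagreb index is $M_1^\alpha(G)=\sum_{u\in V(G)} d_u^\alpha$. For $n\ge 4$, $3\le\Delta\le n-1$ and $q=\lfloor \frac{n}{\Delta-1}\rfloor$, define the $n$-tuple $\mathbf{z}$ as follows. If $q=1$ or $n=2\Delta-2$, then $\mathbf{z}=(\Delta,\,n-\Delta+1,\,2,\,1,\dots,1)$ with $n-3$ entries equal to $1$ at the end. If $q\ge 2$ and $n\ne 2\Delta-2$, then $\mathbf{z}=(z_1,\dots,z_n)$ with $z_j=\Delta$ for $1\le j\le q$, $z_{q+1}=n-q(\Delta-1)+1$, and $z_j=1$ for $q+1<j\le n$. $\mathcal{K}_n^\Delta$ is the set of unicyclic graphs with $n$ vertices whose degree sequence (in non-increasing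 order) is $\mathbf{z}$. *)

(* Defs.v *)
From mathcomp Require Import all_boot all_order all_algebra.
From mathcomp Require Import reals exp.

Set Implicit Arguments.
Unset Strict Implicit.
Unset Printing Implicit Defensive.

Import Order.TTheory GRing.Theory Num.Theory.

Local Open Scope ring_scope.

(* Connectedness and nonemptiness of the edge set are standing assumptions on
   all graphs, so they are part of the structure. *)
Record sgraph := SGraph {
  vertex :> finType;
  adj : rel vertex;
  adj_sym : symmetric adj;
  adj_irrefl : irreflexive adj;
  sgraph_connected : forall x y : vertex, connect adj x y;
  sgraph_has_edge : exists x y : vertex, adj x y }.

Definition degree (G : sgraph) (x : G) : nat := #|[set y | adj x y]|.

Definition max_degree (G : sgraph) : nat := \max_(x : G) degree x.

Definition degree_sequence (G : sgraph) : seq nat :=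
  sort geq [seq degree x | x <- enum G].

(* A cycle is a subgraph, identified with its set of edges, each edge being the
   set of its endpoints: a cyclic sequence of vertices would instead yield one
   copy of the cycle for each rotation and reflection. *)
Definition cycle_edges (T : finType) (c : seq T) : {set {set T}} :=
  [set [set x; next c x] | x in c].

Definition is_cycle (G : sgraph) (C : {set {set G}}) : Prop :=
  exists c : seq G,
    [/\ (3 <= size c)%N, ucycle (@adj G) c & C = cycle_edges c].

Definition unicyclic (G : sgraph) : Prop :=
  exists! C : {set {set G}}, is_cycle C.

Definition first_zagreb (R : realType) (alpha : R) (G : sgraph) : R :=
  \sum_(x : G) (degree x)%:R `^ alpha.

(* For 4 <= n and 3 <= Delta <= n - 1 no subtraction below is truncated. *)
Definition z_sequence (n Delta : nat) : seq nat :=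
  let q := (n %/ (Delta - 1))%N in
  if (q == 1)%N || (n == 2 * Delta - 2)%N then
    [:: Delta; (n - Delta + 1)%N; 2%N] ++ nseq (n - 3) 1%N
  else
    nseq q Delta ++ (n - q * (Delta - 1) + 1)%N :: nseq (n - q - 1) 1%N.

Definition K_class (n Delta : nat) (G : sgraph) : Prop :=
  [/\ unicyclic G, #|G| = n & degree_sequence G = z_sequence n Delta].

(* Main.v *)
(** A spanning tree given by a depth-decreasing parent function has [n - 1]
    edges, and distinct non-tree edges have distinct fundamental cycles, so a
    unicyclic graph has exactly one non-tree edge and its degrees sum to [2n].
    Its cycle supplies three vertices of degree at least [2]. Subtracting
    [1] from every degree leaves numbers between [0] and [m = Delta - 1] with
    sum [n]. For strictly convex [g], merging two partially
    filled blocks of capacity [m] strictly increases the sum of [g], which makes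
    the greedy packing into full blocks, one remainder and zeros the unique
    maximizer; when this packing has only two positive entries, set one block
    [m] aside and move everything but [1] of the others into a single entry. *)

Require Import Defs.
From mathcomp Require Import all_boot all_order all_algebra.
From mathcomp Require Import reals sequences exp.
From mathcomp Require Import zify ring lra.

Set Implicit Arguments.
Unset Strict Implicit.
Unset Printing Implicit Defensive.

Import Order.TTheory GRing.Theory Num.Theory.

(** * Spanning trees given by parent functions *)

(** Here [d] is the distance from the root, and the parent of [x] is the last vertex but one on a
    shortest path to [x]. *)
Lemma parent_function (T : finType) (e : rel T) (r : T) :
  (forall x, connect e r x) ->
  exists (par : T -> T) (d : T -> nat),
    forall x, x != r -> e (par x) x /\ (d (par x) < d x)%N.
Proof.
move=> conn; pose P x n := [exists p : n.-tuple T, path e r p && (last r p == x)].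
have exP x : exists n, P x n.
  have /connectP[p ep ->] := conn x.
  by exists (size p); apply/existsP; exists (in_tuple p); rewrite /= ep eqxx.
pose d x := ex_minn (exP x).
have parP x : exists y, (x != r) ==> e y x && (d y < d x)%N.
  have [->|x_neq] := eqVneq x r; first by exists r.
  rewrite /= {2}/d; case: ex_minnP => n /existsP[[p /= /eqP <-]] {n}.
  case/lastP: p => [|p z /=]; first by rewrite eq_sym (negPf x_neq).
  rewrite rcons_path last_rcons size_rcons => /andP[/andP[ep ez] /eqP zx] _.
  exists (last r p); rewrite -zx ez ltnS /d; case: ex_minnP => n _; apply.
  by apply/existsP; exists (in_tuple p); rewrite /= ep eqxx.
exists (fun x => xchoose (parP x)), d => x x_neq.
by have /implyP/(_ x_neq)/andP := xchooseP (parP x).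
Qed.

(** The tests against [r] are there because the value of [par] at the root is arbitrary. *)
Definition tree_adj (T : finType) (r : T) (par : T -> T) : rel T :=
  fun x y => ((x != r) && (par x == y)) || ((y != r) && (par y == x)).

Lemma tree_adj_sym (T : finType) (r : T) (par : T -> T) :
  symmetric (tree_adj r par).
Proof. by move=> x y; rewrite /tree_adj orbC. Qed.

Lemma tree_adj_connected (T : finType) (r : T) (par : T -> T) (d : T -> nat) :
  (forall x, x != r -> (d (par x) < d x)%N) ->
  forall x y, connect (tree_adj r par) x y.
Proof.
move=> dP x y; have toroot z : connect (tree_adj r par) z r.
  have [n] := ubnP (d z); elim: n z => // n IHn z; rewrite ltnS => dz.
  have [->|z_neq] := eqVneq z r; first exact: connect0.
  apply: connect_trans (IHn (par z) (leq_trans (dP z z_neq) dz)).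
  by apply: connect1; rewrite /tree_adj z_neq eqxx.
apply: connect_trans (toroot x) _.
by rewrite (sym_connect_sym (@tree_adj_sym _ r par)) toroot.
Qed.

(** * Cycles and fundamental cycles *)

(** If both neighbours agreed, two steps forward would lead back to [x], which is impossible on
    three or more distinct vertices. *)
Lemma next_neq_prev (T : eqType) (c : seq T) (x : T) :
  uniq c -> (2 < size c)%N -> x \in c -> next c x != prev c x.
Proof.
move=> c_uniq c_size /rot_to[i c' ec].
apply/eqP => nx; have : next c (next c x) = x by rewrite nx next_prev.
rewrite -!(next_rot i c_uniq) ec.
have : uniq (x :: c') by rewrite -ec rot_uniq.
have : (2 < size (x :: c'))%N by rewrite -ec size_rot.
clear; case: c' => [|a [|b c']] //= _.
rewrite !inE !negb_or !eqxx => /and3P[/and3P[xa xb _] _ _] bx.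
by rewrite eq_sym (negPf xa) in bx; rewrite bx eqxx in xb.
Qed.

Lemma degree_cycle (G : sgraph) (c : seq G) (x : G) :
  ucycle (@adj G) c -> (2 < size c)%N -> x \in c -> (1 < degree x)%N.
Proof.
move=> /andP[c_adj c_uniq] c_size xc.
rewrite /degree (cardsD1 (next c x)) (cardsD1 (prev c x)) !inE.
rewrite next_cycle // eq_sym (next_neq_prev c_uniq c_size xc) /=.
by rewrite adj_sym prev_cycle.
Qed.

Lemma set2_inj (T : finType) (a b c d : T) : [set a; b] = [set c; d] ->
  a = c /\ b = d \/ a = d /\ b = c.
Proof.
move=> e.
have /set2P ha : a \in [set c; d] by rewrite -e set21.
have /set2P hb : b \in [set c; d] by rewrite -e set22.
have /set2P hc : c \in [set a; b] by rewrite e set21.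
have /set2P hd : d \in [set a; b] by rewrite e set22.
by case: ha hb hc hd => -> [] -> [] ? [] ?; subst;
  (left; split; done) || (right; split; done).
Qed.

(** The cycle closes a repetition-free [t]-path from [x] to [y] by the edge [xy]. That path has at
    least two edges, since [xy] is neither a loop nor a [t]-edge. The last clause makes [xy]
    recoverable from the cycle, as its only edge outside [t]. *)
Lemma fundamental_cycle (G : sgraph) (t : rel G) (x y : G) :
  subrel t (@adj G) -> connect t x y -> adj x y -> ~~ t x y ->
  exists C : {set {set G}}, [/\ is_cycle C, [set x; y] \in C &
    forall E, E \in C -> E = [set x; y] \/ exists u v, t u v /\ E = [set u; v]].
Proof.
move=> tadj /connectP[p tp ep] xy ntxy; move: ep xy ntxy.
case/shortenP: tp => {}p tp p_uniq _ -> xy ntxy.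
have p_size : (2 < size (x :: p))%N.
  by case: p tp xy ntxy {p_uniq} => [|a [|b p]] //=;
    rewrite ?adj_irrefl // andbT => ->.
have adjp : ucycle (@adj G) (x :: p).
  by rewrite /ucycle p_uniq andbT /= rcons_path (sub_path tadj) //= adj_sym.
have next_last : next (x :: p) (last x p) = x.
  suff <- : prev (x :: p) x = last x p by rewrite next_prev.
  rewrite prev_nth mem_head memNindex; last by case/andP: p_uniq.
  by rewrite -[size p]/(size (x :: p)).-1 nth_last.
exists (cycle_edges (x :: p)); split.
- by exists (x :: p).
- by apply/imsetP; exists (last x p); rewrite ?mem_last // next_last setUC.
move=> E /imsetP[u uc ->].
(* The closed walk is a cycle for [e'], so [next_cycle] yields the required alternative at every
   vertex. *)
pose e' : rel G := fun u v => t u v || ([set u; v] == [set x; last x p]).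
have : cycle e' (x :: p).
  rewrite /= rcons_path; apply/andP; split.
    by apply: sub_path tp => a b ab; rewrite /e' ab.
  by rewrite /e' setUC eqxx orbT.
move/next_cycle/(_ uc)/orP => [tu|/eqP]; last by left.
by right; exists u, (next (x :: p) u).
Qed.

Lemma tree_acyclic (T : finType) (r : T) (par : T -> T) (d : T -> nat) (c : seq T) :
  (forall x, x != r -> (d (par x) < d x)%N) ->
  (2 < size c)%N -> uniq c -> ~~ cycle (tree_adj r par) c.
Proof.
move=> dP c_size c_uniq; apply/negP => tc.
have [x0 x0c] : exists x0, x0 \in c.
  by case: (c) c_size => // x0 c' _; exists x0; rewrite mem_head.
(* Both neighbours on the cycle of a deepest vertex would be its parent. *)
pose v := [arg max_(v > x0 in c) d v].
have [vc vmax] : v \in c /\ forall u, u \in c -> (d u <= d v)%N.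
  by rewrite /v; case: arg_maxnP.
have par_v u : u \in c -> tree_adj r par v u -> par v = u.
  move=> uc /orP[]/andP[neq /eqP] // ev; have := dP u neq.
  by rewrite ev ltnNge vmax.
have e1 : par v = next c v by apply: par_v; rewrite ?mem_next ?next_cycle.
have e2 : par v = prev c v.
  by apply: par_v; rewrite ?mem_prev // tree_adj_sym prev_cycle.
by have := next_neq_prev c_uniq c_size vc; rewrite -e1 e2 eqxx.
Qed.

(** * Degrees in a unicyclic graph *)

Lemma sum_degree (G : sgraph) :
  (\sum_(x : G) degree x = \sum_(x : G) \sum_(y : G) adj x y)%N.
Proof.
apply: eq_bigr => x _; rewrite /degree cardE -sum1_size big_enum_cond /=.
by rewrite big_mkcond /=; apply: eq_bigr => y _; rewrite andbT inE; case: adj.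
Qed.

Lemma unicyclic_sum_degree (G : sgraph) :
  unicyclic G -> (\sum_(x : G) degree x = 2 * #|G|)%N.
Proof.
case=> C0 [[c [c_size c_ucyc _]] C0_uniq].
have [r _] := sgraph_has_edge G.
have [par [d parP]] := parent_function (sgraph_connected r).
pose t := tree_adj r par; have t_sym : symmetric t := @tree_adj_sym G r par.
have dP x : x != r -> (d (par x) < d x)%N by move=> /parP[].
have tadj : subrel t (@adj G).
  by move=> x y /orP[]/andP[/parP[e _] /eqP <-] //; rewrite adj_sym.
have t_conn := tree_adj_connected dP.
(* Without a non-tree edge, the cycle [c] of the graph would lie in the tree. *)
have /existsP[x0 /existsP[y0 /andP[xy0 ntxy0]]] :
    [exists x : G, exists y : G, adj x y && ~~ t x y].
  apply/contraT => noext; have /andP[c_cyc c_uniq] := c_ucyc.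
  case/negP: (tree_acyclic dP c_size c_uniq).
  apply: cycle_from_next => // x xc; apply: contraNT noext => ntx.
  by apply/existsP; exists x; apply/existsP; exists (next c x); rewrite ntx next_cycle.
have [C1 [cycC1 xyC1 _]] := fundamental_cycle tadj (t_conn x0 y0) xy0 ntxy0.
(* By uniqueness of the cycle, the edge [x0 y0] lies on the fundamental cycle of [x y], whose other
   edges all belong to the tree. *)
have only x y : adj x y -> ~~ t x y -> [set x; y] = [set x0; y0].
  move=> xy ntxy.
  have [C2 [cycC2 _ C2P]] := fundamental_cycle tadj (t_conn x y) xy ntxy.
  move: xyC1; rewrite -(C0_uniq _ cycC1) (C0_uniq _ cycC2) => /C2P[-> //|].
  move=> [u [v [tuv /set2_inj[[eu ev]|[eu ev]]]]]; case/negP: ntxy0.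
    by rewrite eu ev.
  by rewrite eu ev t_sym.
(* Each edge has two orientations: one pair of terms for parent edges, one for the extra edge. At
   most one of the four terms is nonzero; for the parent terms this holds because [d] decreases
   towards the root. *)
have adjE x y : (adj x y : nat) = ((x != r) && (par x == y)
   + ((y != r) && (par y == x))
   + ((x0 == x) && (y0 == y) + (y0 == x) && (x0 == y)))%N.
  have [txy|ntxy] := boolP (t x y).
    rewrite (tadj _ _ txy).
    have -> : (x0 == x) && (y0 == y) = false.
      by apply: contraNF ntxy0 => /andP[/eqP -> /eqP ->].
    have -> : (y0 == x) && (x0 == y) = false.
      by apply: contraNF ntxy0 => /andP[/eqP -> /eqP ->]; rewrite t_sym.
    move: txy; rewrite /t /tree_adj.
    case: (boolP (_ && _)) => [/andP[xr /eqP ex]|_ /= ->] //.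
    case: (boolP (_ && _)) => [/andP[yr /eqP ey]|] //.
    by have := dP y yr; have := dP x xr; rewrite ex ey; lia.
  move: (ntxy); rewrite /t /tree_adj negb_or => /andP[/negPf -> /negPf ->].
  have [xy|nxy] := boolP (adj x y).
    have neq_xy : x != y by apply: contraTneq xy => ->; rewrite adj_irrefl.
    by have [[<- <-]|[<- <-]] := set2_inj (only x y xy ntxy);
      rewrite !eqxx (negPf neq_xy) andbF.
  have -> : (x0 == x) && (y0 == y) = false.
    by apply: contraNF nxy => /andP[/eqP <- /eqP <-].
  apply/esym/eqP; rewrite eqb0; apply: contraNN nxy => /andP[/eqP <- /eqP <-].
  by rewrite adj_sym.
have sum1 (b : bool) (a : G) : (\sum_(y : G) (b && (a == y)) = b)%N.
  rewrite (bigD1 a) //= eqxx andbT big1 ?addn0 // => y /negPf.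
  by rewrite eq_sym => ->; rewrite andbF.
have sum_edge a b : (\sum_(x : G) \sum_(y : G) ((a == x) && (b == y)) = 1)%N.
  under eq_bigr => x _ do rewrite sum1.
  exact: (sum1 true).
have sum_par : (\sum_(x : G) \sum_(y : G) ((x != r) && (par x == y)) = #|G|.-1)%N.
  under eq_bigr => x _ do rewrite sum1.
  rewrite -(cardC1 r) -sum1_card [RHS]big_mkcond /=.
  by apply: eq_bigr => x _; rewrite !inE; case: (x == r).
have G_gt0 : (0 < #|G|)%N by apply/card_gt0P; exists r.
rewrite sum_degree.
under eq_bigr => x _ do (under eq_bigr => y _ do rewrite adjE); rewrite /=.
under eq_bigr => x _ do rewrite !big_split /=.
(* The four terms contribute [n - 1], [n - 1], [1] and [1]. *)
rewrite !big_split /= !sum_edge sum_par exchange_big /= sum_par.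
by rewrite addnACA !addn1 prednK // mul2n addnn.
Qed.

Lemma unicyclic_degree_gt1 (G : sgraph) :
  unicyclic G -> (2 < #|[set x : G | (1 < degree x)%N]|)%N.
Proof.
case=> C0 [[c [c_size c_ucyc _]] _].
apply: (leq_trans c_size); rewrite -(card_uniqP (ucycle_uniq c_ucyc)).
apply/subset_leq_card/subsetP => x xc; rewrite inE.
exact: degree_cycle c_ucyc c_size xc.
Qed.

Lemma degree_gt0 (G : sgraph) (x : G) : (0 < degree x)%N.
Proof.
have [a [b ab]] := sgraph_has_edge G.
have [y xy] : exists y, y != x.
  have [ax|] := eqVneq a x; last by exists a.
  by exists b; apply: contraTneq ab => ->; rewrite ax adj_irrefl.
have /connectP[[|z p] /= xp yE] := sgraph_connected x y.
  by rewrite yE eqxx in xy.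
by apply/card_gt0P; exists z; rewrite inE; case/andP: xp.
Qed.

Local Open Scope ring_scope.

(** * Strict convexity on the natural numbers *)

Definition strictly_convex (R : realFieldType) (g : nat -> R) :=
  forall i, g i.+1 + g i.+1 < g i + g i.+2.

(** Spreading two numbers apart with their sum fixed increases the sum of [g]. By [step] the
    increments of [g] grow strictly; adding [t] such comparisons at distance [u] gives the claim. *)
Lemma strictly_convex_exchange (R : realFieldType) (g : nat -> R) (x t u : nat) :
  strictly_convex g -> (0 < t)%N -> (0 < u)%N ->
  g (x + t)%N + g (x + u)%N < g x + g (x + t + u)%N.
Proof.
move=> gP; have step y v : (0 < v)%N -> g y.+1 + g (y + v)%N < g y + g (y + v).+1.
  case: v => // v _; elim: v => [|v IHv]; first by rewrite addn1; apply: gP.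
  rewrite !addnS in IHv *; have := gP (y + v).+1; lra.
move=> t_gt0 u_gt0; case: t t_gt0 => // t _; elim: t => [|t IHt].
  by rewrite addn1 addSn; apply: step.
have := step (x + t.+1)%N u u_gt0; rewrite !addnS !addSn in IHt *; lra.
Qed.

Lemma powR_gt_tangent (R : realType) (alpha x : R) :
  alpha < 0 \/ 1 < alpha -> 0 < x -> x != 1 ->
  1 + alpha * (x - 1) < x `^ alpha.
Proof.
move=> alphaP x_gt0 x_neq1; rewrite /powR gt_eqF //.
(* Substituting [x = expR L], the claim is a combination of instances of
   [1 + y <= expR y], one of them strict. *)
set L := ln x; have L_neq0 : L != 0.
  by apply: contra x_neq1 => /eqP L0; rewrite -(lnK x_gt0) -/L L0 expR0.
have expL : expR L = x by rewrite lnK.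
case: alphaP => [alpha_lt0|alpha_gt1].
  have h1 : 1 + alpha * L <= expR (alpha * L) by exact: expR_ge1Dx.
  have h2 : 1 + L < x by rewrite -expL; apply: expR_gt1Dx.
  nra.
have h1 : 1 + (alpha - 1) * L <= expR ((alpha - 1) * L) by exact: expR_ge1Dx.
(* For [alpha > 1] a lower bound on [L] is needed: after multiplication by [x] this one reads
   [x - 1 < x * L]. *)
have h2 : 1 - L < expR (- L) by apply: expR_gt1Dx; rewrite oppr_eq0.
have h3 : expR (alpha * L) = expR ((alpha - 1) * L) * x.
  by rewrite -expL -expRD; congr expR; ring.
have h4 : expR (- L) * x = 1 by rewrite -expL mulrC expRxMexpNx_1.
have h5 : (1 - L) * x < expR (- L) * x by rewrite ltr_pM2r.
rewrite h4 in h5.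
have h6 : (1 + (alpha - 1) * L) * x <= expR (alpha * L) by rewrite h3 ler_pM2r.
have h7 : (alpha - 1) * ((1 - L) * x) < (alpha - 1) * 1 by rewrite ltr_pM2l ?subr_gt0.
lra.
Qed.

(** The tangent at [c = i + 2], rescaled from the one at [1], lies strictly below the power at
    [i + 1] and [i + 3], and its slope terms cancel in the sum. The shift fits degrees lowered by
    one and keeps the base positive. *)
Lemma strictly_convex_powR (R : realType) (alpha : R) :
  alpha < 0 \/ 1 < alpha -> strictly_convex (fun i => i.+1%:R `^ alpha : R).
Proof.
move=> alphaP i /=; set c : R := i.+2%:R.
have c_gt0 : 0 < c by rewrite ltr0n.
have scale (k : nat) : (0 < k)%N -> k != i.+2 ->
    c `^ alpha * (1 + alpha * (k%:R / c - 1)) < k%:R `^ alpha.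
  move=> k_gt0 k_neq; have -> : k%:R `^ alpha = c `^ alpha * (k%:R / c) `^ alpha.
    rewrite -powRM ?ltW ?divr_gt0 ?ltr0n //; congr (_ `^ _).
    by rewrite mulrCA mulfV ?mulr1 // gt_eqF.
  rewrite ltr_pM2l ?powR_gt0 //; apply: powR_gt_tangent => //.
    by rewrite divr_gt0 ?ltr0n.
  apply: contra k_neq => /eqP /(canRL (divfK (lt0r_neq0 c_gt0))).
  by rewrite mul1r => /eqP; rewrite eqr_nat.
have h1 := scale i.+1 isT ltac:(lia); have h2 := scale i.+3 isT ltac:(lia).
have e1 : i.+1%:R / c = 1 - c^-1.
  by rewrite -[i.+1%:R](addrK 1) natr1 mulrBl mul1r mulfV // gt_eqF.
have e2 : i.+3%:R / c = 1 + c^-1.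
  by rewrite -[i.+3%:R]natr1 mulrDl mul1r mulfV // gt_eqF.
rewrite {}e1 in h1; rewrite {}e2 in h2.
by move: (c^-1) (c `^ alpha) h1 h2 => v w; lra.
Qed.

(** * Greedy packings as maximizers *)

(** When [s %/ m <= N] there are [N.+1] entries rather than [N]: the remainder keeps its own slot
    even when it is zero. *)
Definition packing (m N s : nat) : seq nat :=
  nseq (s %/ m) m ++ (s %% m)%N :: nseq (N - s %/ m) 0%N.

Lemma sum_packing (R : realFieldType) (g : nat -> R) (m N q r : nat) : (r < m)%N ->
  \sum_(k <- packing m N (q * m + r)) g k
    = g m *+ q + (g r + g 0%N *+ (N - q)).
Proof.
move=> rm; have m_gt0 : (0 < m)%N by lia.
rewrite /packing divnMDl // divn_small // modnMDl modn_small // addn0.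
by rewrite big_cat big_cons /= !big_nseq !iter_addr_0.
Qed.

Lemma count_packing (m N q r : nat) (a : pred nat) : (r < m)%N ->
  count a (packing m N (q * m + r)) = (a m * q + (a r + a 0 * (N - q)))%N.
Proof.
move=> rm; have m_gt0 : (0 < m)%N by lia.
rewrite /packing divnMDl // divn_small // modnMDl modn_small // addn0.
by rewrite count_cat /= !count_nseq.
Qed.

(** If [k] is empty or full, or the packing has zero remainder, the new block only changes the
    order. Otherwise [k] and the remainder [r] are both partial, and merging them gives a strict
    increase. *)
Lemma cons_packing (R : realFieldType) (g : nat -> R) (m N k s : nat) :
  strictly_convex g -> (0 < m)%N -> (k <= m)%N -> (s <= N * m)%N ->
  perm_eq (k :: packing m N s) (packing m N.+1 (k + s)) \/
  \sum_(i <- k :: packing m N s) g i < \sum_(i <- packing m N.+1 (k + s)) g i.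
Proof.
move=> gP m_gt0 km sN; rewrite (divn_eq s m).
set q := (s %/ m)%N; set r := (s %% m)%N.
have rm : (r < m)%N by rewrite ltn_mod.
have qN : (q <= N)%N.
  by rewrite -(leq_pmul2r m_gt0) (leq_trans _ sN) // leq_trunc_div.
have subSq : (N.+1 - q = (N - q).+1)%N by rewrite subSn.
have [->|k_gt0] := posnP k.
  left; apply/permP => a /=; rewrite add0n !count_packing // subSq mulnS; lia.
have [->|k_neq] := eqVneq k m.
  left; apply/permP => a /=; rewrite addnA -mulSn !count_packing // subSS mulnS; lia.
have {k_neq}km : (k < m)%N by rewrite ltn_neqAle k_neq.
have [r0|r_gt0] := posnP r.
  left; apply/permP => a /=; rewrite r0 addn0 [(k + _)%N]addnC.
  rewrite -[X in packing m N X]addn0 !count_packing // subSq mulnS; lia.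
right; rewrite big_cons sum_packing //.
have [rkm|mrk] := ltnP (r + k) m.
  have -> : (k + (q * m + r) = q * m + (r + k))%N by lia.
  rewrite sum_packing // subSq mulrS; move: (g m *+ q) (g 0%N *+ (N - q)) => A B.
  have := strictly_convex_exchange 0 gP r_gt0 k_gt0; rewrite !add0n; lra.
have -> : (k + (q * m + r) = q.+1 * m + (r + k - m))%N by lia.
rewrite sum_packing ?subSS ?mulrS; last by lia.
move: (g m *+ q) (g 0%N *+ (N - q)) => A B.
have t_gt0 : (0 < m - k)%N by lia.
have u_gt0 : (0 < m - r)%N by lia.
(* The blocks [r] and [k] become [m] and the overflow [r + k - m], which is the base point of the
   exchange. *)
have := strictly_convex_exchange (r + k - m) gP t_gt0 u_gt0.
have -> : (r + k - m + (m - k) = r)%N by lia.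
have -> : (r + k - m + (m - r) = k)%N by lia.
have -> : (r + (m - r) = m)%N by lia.
lra.
Qed.

(* The leading [0] keeps both lists of the same length even when every entry
   equals [m], in which case the packing has a spare zero remainder. *)
Lemma perm_packing_or_lt (R : realFieldType) (g : nat -> R) (m : nat) (l : seq nat) :
  strictly_convex g -> (0 < m)%N -> all (fun k => (k <= m)%N) l ->
  perm_eq (0%N :: l) (packing m (size l) (sumn l)) \/
  \sum_(k <- 0%N :: l) g k < \sum_(k <- packing m (size l) (sumn l)) g k.
Proof.
move=> gP m_gt0; elim: l => [_|k l IHl]; first by left; rewrite /packing div0n mod0n.
move=> /= /andP[km lm].
have sl : (sumn l <= size l * m)%N.
  by elim: l lm {IHl} => //= a l IH /andP[am /IH]; lia.
have e0 : perm_eq (0%N :: k :: l) (k :: 0%N :: l).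
  exact: permEl (perm_catCA [:: _] [:: _] l).
rewrite (perm_big _ e0) (permPl e0) /= big_cons.
have step := cons_packing gP m_gt0 km sl; rewrite big_cons in step.
have [lP|lt_l] := IHl lm.
  by rewrite (perm_big _ lP); move: lP; rewrite -(perm_cons k) => /permPl ->.
right; case: step => [/(perm_big _) step|]; last lra.
by rewrite -step [X in _ < X]big_cons ltrD2l.
Qed.

Lemma sumn_gt0 (l : seq nat) : has (leq 1) l -> (0 < sumn l)%N.
Proof.
by case/hasP=> b /perm_to_rem/perm_sumn -> /= b_gt0; rewrite addn_gt0 b_gt0.
Qed.

(** After one positive entry [a] is set aside, the others are collected into one entry, positive
    because a second positive entry exists. Then all of [a] but [1] is moved there. *)
Lemma perm_two_positive_or_lt (R : realFieldType) (g : nat -> R) (l : seq nat) :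
  strictly_convex g -> (2 <= count (leq 1) l)%N ->
  let z := [:: (sumn l).-1, 1 & nseq (size l - 2) 0]%N in
  perm_eq l z \/ \sum_(k <- l) g k < \sum_(k <- z) g k.
Proof.
move=> gP l2 z.
have [|a la a_gt0] := @hasP _ (leq 1) l _.
  by rewrite has_count; apply: leq_trans l2.
have lP := perm_to_rem la; set l' := rem a l in lP.
have szl := perm_size lP; have suml := perm_sumn lP.
move: l2; rewrite (permP lP) /= a_gt0 /= => l'1.
rewrite add1n ltnS -has_count in l'1.
have l'_gt0 := sumn_gt0 l'1.
rewrite /= in szl suml.
have l'le : all (fun k => (k <= (sumn l').+1)%N) l'.
  apply/allP => b /perm_to_rem/perm_sumn /=; lia.
(* With a capacity exceeding the sum, the packing is a single entry. *)
have pk : packing (sumn l').+1 (size l') (sumn l') = sumn l' :: nseq (size l') 0%N.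
  by rewrite /packing divn_small // modn_small // subn0.
have sz' : (0 < size l')%N by case: (l') l'1.
have := perm_packing_or_lt gP (ltn0Sn _) l'le; rewrite pk.
(* One zero is exposed to cancel the leading [0] of [perm_packing_or_lt]. *)
have -> : sumn l' :: nseq (size l') 0%N = sumn l' :: 0%N :: nseq (size l - 2) 0%N.
  by rewrite szl subSS subn1; case: (size l') sz'.
set w := nseq _ _ in z *.
have cz : perm_eq [:: sumn l', 0%N & w] [:: 0%N, sumn l' & w].
  exact: permEl (perm_catCA [:: _] [:: _] w).
rewrite (permPr cz) (perm_big _ cz) perm_cons /= !big_cons.
rewrite (permPl lP) (perm_big _ lP) /= /z suml !big_cons.
have az : perm_eq [:: sumn l', 1%N & w] [:: 1%N, sumn l' & w].
  exact: permEl (perm_catCA [:: _] [:: _] w).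
(* If [a] or [sumn l'] equals [1], the pair already has the extremal form and strictness can only
   come from [l']. *)
have [-> l'P|a_neq1 l'P] := eqVneq a 1%N.
  rewrite add1n -pred_Sn (permPr az) perm_cons.
  by case: l'P => [|lt_l']; [left|right; lra].
have [s1|s_neq1] := eqVneq (sumn l') 1%N.
  rewrite s1 in l'P *; rewrite addn1 -pred_Sn perm_cons.
  by case: l'P => [|lt_l']; [left|right; lra].
right; have t_gt0 : (0 < a - 1)%N by lia.
have u_gt0 : (0 < sumn l' - 1)%N by lia.
have := strictly_convex_exchange 1 gP t_gt0 u_gt0.
have -> : (1 + (a - 1) + (sumn l' - 1) = (a + sumn l').-1)%N by lia.
have -> : (1 + (a - 1) = a)%N by lia.
have -> : (1 + (sumn l' - 1) = sumn l')%N by lia.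
case: l'P => [l'P|]; last lra.
rewrite (perm_big _ l'P) /= big_cons; lra.
Qed.

(** * Extremality and ordering of [z_sequence] *)

(** The entries of [l] are degrees minus one. In the first case of [z_sequence] an entry [m] is set
    aside; at least two positive entries remain, and the capacity can be ignored for them. In the
    other case the greedy packing itself is the maximizer. *)
Lemma perm_z_sequence_or_lt (R : realFieldType) (f : nat -> R) (m : nat) (l : seq nat) :
  strictly_convex (fun k => f k.+1) -> (1 < m)%N -> m \in l ->
  all (fun k => (k <= m)%N) l -> (2 < count (leq 1) l)%N -> sumn l = size l ->
  let D := map S l in let z := z_sequence (size l) m.+1 in
  perm_eq D z \/ \sum_(d <- D) f d < \sum_(d <- z) f d.
Proof.
move=> fP m_gt1 ml l_le l_pos suml D z.
have m_gt0 : (0 < m)%N by apply: ltnW.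
suff [w [wz]] : exists w, map S w = z /\
    (perm_eq l w \/ \sum_(k <- l) f k.+1 < \sum_(k <- w) f k.+1).
  rewrite /D -wz !big_map => -[lw|]; last by right.
  by left; apply: perm_map.
rewrite /z /z_sequence subSS subn0; case: ifP => [_|_].
  have lP := perm_to_rem ml; set l' := rem m l in lP.
  have szl := perm_size lP; have suml' := perm_sumn lP; rewrite /= in szl suml'.
  have l'_pos : (1 < count (leq 1) l')%N.
    by move: l_pos; rewrite (permP lP) /= m_gt0.
  have l'_gt0 : (0 < sumn l')%N by apply: sumn_gt0; rewrite has_count ltnW.
  exists (m :: [:: (sumn l').-1, 1 & nseq (size l' - 2) 0]%N); split.
    rewrite /= map_nseq prednK //; congr [:: _, _, _ & nseq _ _]; lia.
  rewrite (permPl lP) (perm_big _ lP) /= perm_cons big_cons [X in _ < X]big_cons.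
  rewrite ltrD2l.
  exact: (perm_two_positive_or_lt (g := fun k => f k.+1)).
have l_size : (0 < size l)%N by case: (l) ml.
set q := (size l %/ m)%N; have q_lt : (q < size l)%N by rewrite ltn_Pdiv.
(* This is the packing with one zero fewer; [q < size l], which holds since [m > 1], provides the
   zero that matches the leading [0]. *)
exists (nseq q m ++ (size l %% m)%N :: nseq (size l - q - 1) 0%N); split.
  rewrite map_cat /= !map_nseq; congr (_ ++ _ :: _).
  by rewrite [in RHS](divn_eq (size l) m) -/q addKn addn1.
have := perm_packing_or_lt fP m_gt0 l_le; rewrite suml /packing -/q.
set w := _ ++ _ :: nseq (size l - q - 1) _.
have wP : perm_eq (nseq q m ++ (size l %% m)%N :: nseq (size l - q) 0%N) (0%N :: w).
  apply/permP => a; rewrite /w /= !count_cat /= !count_nseq.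
  have -> : (size l - q = (size l - q - 1).+1)%N by lia.
  rewrite /= mulnS; lia.
by rewrite (permPr wP) (perm_big _ wP) perm_cons /= !big_cons ltrD2l.
Qed.

(** Needed because [K_class] compares [z_sequence] with a sorted degree list. *)
Lemma z_sequence_sorted (n m : nat) :
  (1 < m)%N -> (m.+1 < n)%N -> sorted geq (z_sequence n m.+1).
Proof.
move=> m_gt1 mn; rewrite /z_sequence subSS subn0.
have path_nseq x k s : path geq x (nseq k x ++ s) = path geq x s.
  by elim: k => //= k ->; rewrite /geq /= leqnn.
have path_1 x k : (0 < x)%N -> path geq x (nseq k 1%N).
  by case: k => //= k ->; rewrite -[nseq k _]cats0 path_nseq.
case: ifP => [/orP n_small|_].
  rewrite /= path_1 // andbT; suff : (n <= 2 * m)%N by rewrite /geq /=; lia.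
  case: n_small => /eqP; last by lia.
  by move=> q1; have := divn_eq n m; have := ltn_pmod n (ltnW m_gt1); lia.
have rm := ltn_pmod n (ltnW m_gt1); have nE := divn_eq n m.
have : (0 < n %/ m)%N by rewrite divn_gt0; lia.
case: (n %/ m)%N nE => // q nE _.
rewrite /= path_nseq /= path_1 ?addn1 // andbT /geq /=; lia.
Qed.

(** * The bound for graphs *)

Lemma degree_lt_card (G : sgraph) (x : G) : (degree x < #|G|)%N.
Proof.
apply: proper_card; apply/properP; split; first exact/subsetP.
by exists x; rewrite ?inE ?adj_irrefl.
Qed.

Lemma max_degree_attained (G : sgraph) : exists x : G, max_degree G = degree x.
Proof.
have [r _] := sgraph_has_edge G.
have [|x xP] := @bigop.eq_bigmax G (@degree G); last by exists x.
by apply/card_gt0P; exists r.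
Qed.

Lemma max_degree_lt_card (G : sgraph) : (max_degree G < #|G|)%N.
Proof. by have [x ->] := max_degree_attained G; apply: degree_lt_card. Qed.

Lemma first_zagreb_le_z_sequence (R : realType) (G : sgraph) (alpha : R) :
  unicyclic G -> (2 < max_degree G)%N -> alpha < 0 \/ 1 < alpha ->
  let n := #|G| in let z := z_sequence n (max_degree G) in
  let B : R := \sum_(d <- z) d%:R `^ alpha in
  first_zagreb alpha G <= B /\
  (first_zagreb alpha G = B <-> K_class n (max_degree G) G).
Proof.
move=> G_uni Delta_gt2 alphaP n z B.
pose l := [seq (degree x).-1 | x <- enum G].
have lS : map S l = [seq degree x | x <- enum G].
  by rewrite -map_comp; apply: eq_map => x /=; rewrite prednK ?degree_gt0.
have l_size : size l = n by rewrite size_map -cardE.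
have zagrebE : first_zagreb alpha G = \sum_(d <- map S l) d%:R `^ alpha.
  by rewrite lS big_map big_enum.
have [x0 x0_max] := max_degree_attained G.
case DeltaE: (max_degree G) Delta_gt2 (max_degree_lt_card G) => [//|m] m_gt1 m_lt.
rewrite ltnS in m_gt1.
have ml : m \in l.
  by apply/mapP; exists x0; rewrite ?mem_enum // -x0_max DeltaE.
have l_le : all (fun k => (k <= m)%N) l.
  apply/allP => _ /mapP[x _ ->]; rewrite -ltnS prednK ?degree_gt0 // -DeltaE.
  exact: (leq_bigmax x).
have l_pos : (2 < count (leq 1) l)%N.
  apply: leq_trans (unicyclic_degree_gt1 G_uni) _.
  rewrite count_map cardE size_filter -enumT; apply: sub_count => x /=.
  by rewrite inE -subn1 subn_gt0.
have suml : sumn l = size l.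
  have : sumn (map S l) = (2 * n)%N.
    by rewrite lS sumnE big_map big_enum unicyclic_sum_degree.
  have -> : sumn (map S l) = (sumn l + size l)%N by elim: (l) => //= a s ->; lia.
  by rewrite l_size; lia.
have := perm_z_sequence_or_lt (f := fun d => d%:R `^ alpha)
  (strictly_convex_powR alphaP) m_gt1 ml l_le l_pos suml.
rewrite /= l_size -DeltaE -/z -zagrebE -/B lS => dich.
have sortP := @perm_sortP _ geq (fun a b => leq_total b a)
  (fun a b c ab bc => leq_trans bc ab) (fun a b ab => anti_leq (etrans (andbC _ _) ab)).
have z_sorted : sort geq z = z.
  apply: sorted_sort; first by move=> a b c ab bc; apply: leq_trans bc ab.
  by rewrite /z DeltaE z_sequence_sorted.
split.
  case: dich => [Dz|/ltW //].
  by rewrite zagrebE lS /B (perm_big _ Dz).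
(* Equality rules out the strict alternative, so the degrees are a permutation of [z], and sorting
   turns this into equality of sequences. *)
split=> [eqB|[_ _ degE]].
  split=> //; rewrite /degree_sequence -/z -z_sorted; apply/sortP.
  by case: dich => //; rewrite eqB ltxx.
rewrite zagrebE lS /B; apply: perm_big; apply/sortP.
by rewrite z_sorted -[RHS]degE.
Qed.

Theorem theorem4p12 (R : realType) (G : sgraph) (n Delta q : nat) (alpha : R)
    (hG : unicyclic G) (hn : #|G| = n) (n4 : (4 <= n)%N)
    (hDelta : max_degree G = Delta) (Delta3 : (3 <= Delta)%N)
    (hq : q = (n %/ (Delta - 1))%N) (halpha : alpha < 0 \/ 1 < alpha) :
  ((q = 1%N \/ n = (2 * Delta - 2)%N) ->
     let B := Delta%:R `^ alpha + (n%:R - Delta%:R + 1) `^ alpha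
              + 2 `^ alpha + n%:R - 3 in
     first_zagreb alpha G <= B /\
     (first_zagreb alpha G = B <-> K_class n Delta G)) /\
  ((1 < q)%N /\ n <> (2 * Delta - 2)%N ->
     let B := q%:R * Delta%:R `^ alpha
              + (n%:R - q%:R * (Delta%:R - 1) + 1) `^ alpha
              + n%:R - q%:R - 1 in
     first_zagreb alpha G <= B /\
     (first_zagreb alpha G = B <-> K_class n Delta G)).
Proof.
have [] := first_zagreb_le_z_sequence hG _ halpha; first by rewrite hDelta.
rewrite hn hDelta => le_B eq_B.
have Delta_lt : (Delta < n)%N by rewrite -hn -hDelta max_degree_lt_card.
suff [B1 B2] : ((q = 1%N \/ n = (2 * Delta - 2)%N) ->
    \sum_(d <- z_sequence n Delta) d%:R `^ alpha
    = Delta%:R `^ alpha + (n%:R - Delta%:R + 1) `^ alpha + 2 `^ alpha + n%:R - 3) /\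
  ((1 < q)%N /\ n <> (2 * Delta - 2)%N ->
    \sum_(d <- z_sequence n Delta) d%:R `^ alpha
    = q%:R * Delta%:R `^ alpha + (n%:R - q%:R * (Delta%:R - 1) + 1) `^ alpha
      + n%:R - q%:R - 1).
  by split=> [/B1|/B2] <-.
rewrite /z_sequence -hq; split.
  move=> hq1; rewrite ifT; last by case: hq1 => ->; rewrite eqxx ?orbT.
  rewrite !big_cons big_nseq iter_addr_0 powR1 natrB ?natrD ?natrB 1?ltnW //.
  lra.
move=> [q_gt1 n_neq]; rewrite ifF; last by apply/negbTE; rewrite negb_or; lia.
(* These two bounds ensure that the subtractions of [q * (Delta - 1)] and [q] from [n] are not
   truncated, so they agree with those in [R]. *)
have q_le : (q * (Delta - 1) <= n)%N by rewrite hq leq_trunc_div.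
have q_lt : (q < n)%N by rewrite hq ltn_Pdiv; lia.
rewrite big_cat big_cons /= !big_nseq !iter_addr_0 powR1 -subnDA.
rewrite -[_ *+ q]mulr_natl natrD !natrB ?natrM ?natrB ?natrD; [|lia..].
lra.
Qed.
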